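(* Let $(R,f,g)$ be a commutative Krasner $(m,n)$-hyperring with scalar identity $1$, and let $S$ be an $n$-ary multiplicative subset of $R$ with $1\in S$. Let $I$ be a hyperideal of $R$ such that $S\cap I=\varnothing$. If $\bar S=\{f(s,I,0^{(m-2)}) : s\in S\}\subseteq R/I$, then $$\bar S^{-1}(R/I)\cong S^{-1}R/S^{-1}I$$ as Krasner $(m,n)$-hyperrings, where $S^{-1}I=\{\frac as : a\in I,\ s\in S\}$.
   Context: Let $m,n\ge 2$. Notation: $x_i^j$ denotes the sequence $x_i,\dots,x_j$ (empty if $j<i$); $x^{(k)}$ denotes $x$ repeated $k$ times. An $m$-ary hyperoperation on $R$ is a map $f$ from $R^m$ to the set of non-empty subsets of $R$, extended to non-empty subsets by $f(A_1,\dots,A_m)=\bigcup\{f(x_1^m): x_i\in A_i\}$; singletons are identified with their elements. It is associative if $f(x_1^{i-1},f(x_i^{m+i-1}),x_{m+i}^{2m-1})=f(x_1^{j-1},f(x_j^{m+j-1}),x_{m+j}^{2m-1})$ for all $1\le i<j\le m$ and all $x_1^{2m-1}$, and commutative if its value is unchanged under permuting the arguments. $(R,f)$ is an $m$-ary hypergroup if $f$ is associative and each equation $b\in f(a_1^{i-1},x_i,a_{i+1}^m)$ has a solution $x_i\in R$. Canonical $m$-ary hypergroup: a (commutative) $m$-ary hypergroup such that (1) there is a unique $e$ with $f(x,e^{(m-1)})=x$ for all $x$; (2) for every $x$ there is a unique $x^{-1}$ with $e\in f(x,x^{-1},e^{(m-2)})$; (3) if $x\in f(x_1^m)$ then $x_i\in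 f(x,x_1^{-1},\dots,x_{i-1}^{-1},x_{i+1}^{-1},\dots,x_m^{-1})$ for all $i$. Krasner $(m,n)$-hyperring $(R,f,g)$: (1) $(R,f)$ is a canonical $m$-ary hypergroup, with $e$ written $0$ and $x^{-1}$ written $-x$; (2) $(R,g)$ is an $n$-ary semigroup ($g:R^n\to R$ associative); (3) $g(a_1^{i-1},f(x_1^m),a_{i+1}^n)=f(g(a_1^{i-1},x_1,a_{i+1}^n),\dots,g(a_1^{i-1},x_m,a_{i+1}^n))$ for all $i$; (4) $g(x_1^n)=0$ whenever some $x_i=0$. It is commutative if $f$ and $g$ are commutative. A scalar identity is an element $1$ with $x=g(x,1^{(n-1)})$ for all $x$. A non-empty $S\subseteq R$ is $n$-ary multiplicative if $g(s_1^n)\in S$ for all $s_1,\dots,s_n\in S$. Hyperideal: a non-empty $I\subseteq R$ such that $(I,f)$ is an $m$-ary subhypergroup of $(R,f)$ (i.e. $f(x_1^m)\subseteq I$ for $x_1^m\in I$, and each equation $b\in f(b_1^{i-1},x_i,b_{i+1}^m)$ with $b,b_j\in I$ has a solution $x_i\in I$) and $g(x_1^{i-1},I,x_{i+1}^n)\subseteq I$ for all $x_1^n\in R$ and $1\le i\le n$. Homomorphism: a map $\psi:(R_1,f_1,g_1)\to(R_2,f_2,g_2)$ with $\psi(f_1(x_1^m))=f_2(\psi(x_1),\dots,\psi(x_m))$ and $\psi(g_1(y_1^n))=g_2(\psi(y_1),\dots,\psi(y_n))$ for all $x_1^m,y_1^n\in R_1$. An isomorphism is a bijective homomorphism; $\cong$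 means an isomorphism exists. Quotient: for a hyperideal $I$ of $R$, $R/I=\{f(r,I,0^{(m-2)}) : r\in R\}$, with the $m$-ary hyperoperation sending $f(r_1,I,0^{(m-2)}),\dots,f(r_m,I,0^{(m-2)})$ to $\{f(r,I,0^{(m-2)}) : r\in f(r_1^m)\}$ and the $n$-ary operation sending $f(r_1,I,0^{(m-2)}),\dots,f(r_n,I,0^{(m-2)})$ to $f(g(r_1^n),I,0^{(m-2)})$; it is a commutative Krasner $(m,n)$-hyperring with zero $I$ and scalar identity $f(1,I,0^{(m-2)})$. The same construction applies to $(S^{-1}R,F,G)$ and its hyperideal $S^{-1}I$. Product convention: $g(a_1,\dots,a_k,1^{(n-k)})$ is literal for $k\le n$; for $k>n$ it means the iterated operation $g$ applied to $a_1,\dots,a_k$ padded with $1$'s. Hyperring of fractions (for any commutative Krasner $(m,n)$-hyperring $R$ with scalar identity and any $n$-ary multiplicative subset $S\ni 1$; applied both to $(R,S)$ and to $(R/I,\bar S)$, where $\bar S$ is $n$-ary multiplicative and contains the scalar identity): on $R\times S$, $(r,s)\sim(r',s')$ iff there is $t\in S$ with $0\in g(t,f(g(r,s',1^{(n-2)}),-g(r',s,1^{(n-2)}),0^{(m-2)}),1^{(n-2)})$; this is an equivalence relation, $\frac rs$ is the class of $(r,s)$, and $S^{-1}R$ is the set of classes. With $$F\left(\tfrac{r_1}{s_1},\dots,\tfrac{r_m}{s_m}\right)=\left\{\tfrac rs : r\in f\bigl(g(r_1,s_2^m,1^{(n-m)}),g(s_1,r_2,s_3^m,1^{(n-m)}),\dots,g(s_1^{m-1},r_m,1^{(n-m)})\bigr),\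 s=g(s_1^m,1^{(n-m)})\right\},$$ $$G\left(\tfrac{r_1}{s_1},\dots,\tfrac{r_n}{s_n}\right)=\frac{g(r_1^n)}{g(s_1^n)},$$ $(S^{-1}R,F,G)$ is a commutative Krasner $(m,n)$-hyperring with zero $\frac01$ and scalar identity $\frac11$. *)

(* Defs.v *)
From mathcomp Require Import all_boot perm.
From mathcomp Require Import zify.
From mathcomp Require Import boolp classical_sets.

Set Implicit Arguments.
Unset Strict Implicit.
Unset Printing Implicit Defensive.

Local Open Scope classical_set_scope.

(* A k-tuple of elements of T is a function 'I_k -> T, indexed from 0. *)

(* [pad e s] is the tuple s_0, ..., s_(size s - 1), e, ..., e of length k. *)
Definition pad (k : nat) (T : Type) (e : T) (s : seq T) : 'I_k -> T :=
  fun j => nth e s j.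
Arguments pad {k T} e s _ /.

(* [upd a i y] is a_0, ..., a_(i-1), y, a_(i+1), ..., a_(k-1). *)
Definition upd (k : nat) (T : Type) (a : 'I_k -> T) (i : 'I_k) (y : T) :
  'I_k -> T := fun j => if j == i then y else a j.

(* [splice i x y] is x_0, ..., x_(i-1), y, x_(i+k), ..., x_(2k-2). *)
Definition splice (k : nat) (T : Type) (i : 'I_k) (x : nat -> T) (y : T) :
  'I_k -> T := fun j => if j < i then x j else if j == i then y else x (j + k.-1).

Definition hext (k : nat) (T : Type) (f : ('I_k -> T) -> set T)
    (A : 'I_k -> set T) : set T :=
  [set y | exists2 x : 'I_k -> T, (forall j, A j (x j)) & f x y].

(* In the two associativity axioms only the entries x 0, ..., x (2k-2) of    *)
(* the sequence x matter.                                                    *)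
Definition hyper_associative (k : nat) (T : Type) (f : ('I_k -> T) -> set T) :=
  forall (i j : 'I_k) (x : nat -> T),
    hext f (splice i (fun l => [set x l]) (f (fun l : 'I_k => x (i + l)))) =
    hext f (splice j (fun l => [set x l]) (f (fun l : 'I_k => x (j + l)))).

Definition op_associative (k : nat) (T : Type) (g : ('I_k -> T) -> T) :=
  forall (i j : 'I_k) (x : nat -> T),
    g (splice i x (g (fun l : 'I_k => x (i + l)))) =
    g (splice j x (g (fun l : 'I_k => x (j + l)))).

Definition symmetric_op (k : nat) (T U : Type) (f : ('I_k -> T) -> U) :=
  forall (s : 'S_k) (x : 'I_k -> T), f (fun j => x (s j)) = f x.

Definition hypergroup (k : nat) (T : Type) (f : ('I_k -> T) -> set T) :=
  [/\ forall x, f x !=set0,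
      hyper_associative f &
      forall (i : 'I_k) (a : 'I_k -> T) (b : T), exists x, f (upd a i x) b].

(* In a canonical hypergroup with identity e, this set is a singleton. *)
Definition hinv (k : nat) (T : Type) (f : ('I_k -> T) -> set T) (e x : T) : T :=
  xget (e : {classic T}) [set y | f (pad e [:: x; y]) e].

Record canonical_hypergroup (k : nat) (T : Type) (f : ('I_k -> T) -> set T)
    (e : T) : Prop := CanonicalHypergroup {
  canonical_hypergroupP : hypergroup f;
  canonical_symmetric : symmetric_op f;
  canonical_unit :
    unique (fun u => forall x, f (pad u [:: x]) = [set x]) e;
  canonical_inverse : forall x, exists! y, f (pad e [:: x; y]) e;
  canonical_reversible : forall (x : T) (xs : 'I_k -> T) (i : 'I_k), f xs x ->
    f (pad e (x :: [seq hinv f e (xs j) | j <- enum 'I_k & j != i])) (xs i)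
}.

(* A bare signature: the quotient of a Krasner hyperring, as constructed     *)
(* below, may fail the uniqueness clause of [canonical_unit] when m > 2      *)
(* (Z modulo 2Z with f(x, y, z) = x + y + z), so no axioms are bundled here. *)
(* The constant [hone] has to be part of the data: for n > 2 a scalar        *)
(* identity need not be unique.                                              *)
Record hyperalg (m n : nat) := HyperAlg {
  hsort :> Type;
  hadd : ('I_m -> hsort) -> set hsort;
  hmul : ('I_n -> hsort) -> hsort;
  hzero : hsort;
  hone : hsort
}.
Arguments hadd {m n} h _ _ : rename.
Arguments hmul {m n} h _ : rename.
Arguments hzero {m n} h : rename.
Arguments hone {m n} h : rename.

Definition hopp (m n : nat) (R : hyperalg m n) (x : R) : R :=
  hinv (hadd R) (hzero R) x.

Record krasner_hyperring (m n : nat) (R : hyperalg m n) : Prop := Krasner {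
  krasner_add : canonical_hypergroup (hadd R) (hzero R);
  krasner_mulA : op_associative (hmul R);
  krasner_distr : forall (a : 'I_n -> R) (i : 'I_n) (x : 'I_m -> R),
    [set hmul R (upd a i y) | y in hadd R x] =
    hadd R (fun j => hmul R (upd a i (x j)));
  krasner_mul0 : forall x : 'I_n -> R,
    (exists i, x i = hzero R) -> hmul R x = hzero R
}.

Definition scalar_identity (m n : nat) (R : hyperalg m n) (u : R) : Prop :=
  forall x, x = hmul R (pad u [:: x]).

Record hyperideal (m n : nat) (R : hyperalg m n) (I : set R) : Prop :=
  HyperIdeal {
  hyperideal_nonempty : I !=set0;
  hyperideal_add : forall x : 'I_m -> R, (forall j, I (x j)) ->
    hadd R x `<=` I;
  hyperideal_solve : forall (i : 'I_m) (a : 'I_m -> R) (b : R),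
    (forall j, j != i -> I (a j)) -> I b ->
    exists2 x, I x & hadd R (upd a i x) b;
  hyperideal_mul : forall (x : 'I_n -> R) (i : 'I_n) (a : R), I a ->
    I (hmul R (upd x i a))
}.

Definition homomorphism (m n : nat) (A B : hyperalg m n) (psi : A -> B) :=
  (forall x : 'I_m -> A,
     [set psi y | y in hadd A x] = hadd B (fun j => psi (x j))) /\
  (forall x : 'I_n -> A, psi (hmul A x) = hmul B (fun j => psi (x j))).

Definition isomorphic (m n : nat) (A B : hyperalg m n) : Prop :=
  exists psi : A -> B, bijective psi /\ homomorphism psi.

Definition coset_set (m n : nat) (R : hyperalg m n) (I : set R) (r : R) :
  set R := hext (hadd R) (pad [set hzero R] [:: [set r]; I]).

Definition quot_sort (m n : nat) (R : hyperalg m n) (I : set R) : Type :=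
  {X : set R | exists r, X = coset_set I r}.

Definition coset (m n : nat) (R : hyperalg m n) (I : set R) (r : R) :
  quot_sort I := exist _ (coset_set I r) (ex_intro _ r erefl).

Definition coset_repr (m n : nat) (R : hyperalg m n) (I : set R)
    (X : quot_sort I) : R := sval (cid (svalP X)).

(* The n-ary operation does not depend on the representatives: see           *)
(* [hmul_coset].                                                             *)
Definition quot (m n : nat) (R : hyperalg m n) (I : set R) : hyperalg m n := {|
  hsort := quot_sort I;
  hadd := fun X => [set Y | exists2 r : 'I_m -> R,
            (forall j, X j = coset I (r j)) &
            exists2 y, hadd R r y & Y = coset I y];
  hmul := fun X => coset I (hmul R (fun j => coset_repr (X j)));
  hzero := coset I (hzero R);
  hone := coset I (hone R)
|}.

Section QuotientTheory.
Variables (m n : nat) (R : hyperalg m n) (I : set R).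
Hypotheses (m_gt1 : 1 < m) (n_gt1 : 1 < n).
Hypotheses (krR : krasner_hyperring R) (idI : hyperideal I).

Let addR := krasner_add krR.

Lemma hyperideal0 : I (hzero R).
Proof.
have [a Ia] := hyperideal_nonempty idI.
pose i0 : 'I_n := Ordinal (ltnW n_gt1); pose i1 : 'I_n := Ordinal n_gt1.
have /= := hyperideal_mul idI (fun=> hzero R) i0 Ia.
by rewrite (krasner_mul0 krR) //; exists i1; rewrite /upd.
Qed.

Lemma hoppP (x : R) : hadd R (pad (hzero R) [:: x; hopp x]) (hzero R).
Proof.
have [y [yx _]] := canonical_inverse addR x.
exact: (@xgetPex {classic R} (hzero R)
  [set y | hadd R (pad (hzero R) [:: x; y]) (hzero R)] (ex_intro _ y yx)).
Qed.

Lemma hoppE (x y : R) :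
  hadd R (pad (hzero R) [:: x; y]) (hzero R) -> hopp x = y.
Proof.
move=> xy; have [z [_ zu]] := canonical_inverse addR x.
by rewrite -(zu _ xy) (zu _ (hoppP x)).
Qed.

Lemma hadd_x0 (x : R) : hadd R (pad (hzero R) [:: x]) = [set x].
Proof. by case: (canonical_unit addR) => + _; apply. Qed.

Lemma pad_x0 k (e x : R) : pad e [:: x; e] = pad e [:: x] :> ('I_k -> R).
Proof. by apply/funext=> -[[|[|j]] ?] /=; rewrite ?nth_nil. Qed.

Lemma hopp0 : hopp (hzero R) = hzero R.
Proof. by apply: hoppE; rewrite pad_x0 hadd_x0. Qed.

Lemma coset_setP (r y : R) : coset_set I r y <->
  exists2 a, I a & hadd R (pad (hzero R) [:: r; a]) y.
Proof.
split=> [[x xP xy]|[a Ia ray]]; last first.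
  exists (pad (hzero R) [:: r; a]) => // -[[|[|j]] ?] //=.
  by rewrite !nth_nil.
exists (x (Ordinal m_gt1)); first exact: xP (Ordinal m_gt1).
suff -> : pad (hzero R) [:: r; x (Ordinal m_gt1)] = x by [].
apply/funext=> -[[|[|j]] jm] /=.
- by have /= -> := xP (Ordinal jm).
- by congr x; apply: val_inj.
- by have /= := xP (Ordinal jm); rewrite !nth_nil => ->.
Qed.

Lemma coset_set_sub (x y : R) : coset_set I y x -> coset_set I x `<=` coset_set I y.
Proof.
move=> /coset_setP[a Ia yax] z /coset_setP[b Ib xbz].
pose i0 : 'I_m := Ordinal (ltnW m_gt1); pose i1 : 'I_m := Ordinal m_gt1.
have m0 : (m == 0) = false by case: (m) m_gt1.
have m1 : (m == 1) = false by case: (m) m_gt1 => [|[]].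
pose w k := if k == 0 then y else if k == 1 then a
            else if k == m then b else hzero R.
have [[_ hassoc _] _ _ _ _] := addR.
have : hext (hadd R) (splice i0 (fun l => [set w l])
         (hadd R (fun l : 'I_m => w (i0 + l)))) z.
  exists (pad (hzero R) [:: x; b]) => //.
  move=> -[[|[|j]] jm]; rewrite /splice /=.
  - rewrite (_ : (fun _ => _) = pad (hzero R) [:: y; a]) //.
    apply/funext=> -[[|[|l]] lm] //=; rewrite /w add0n /=.
    by rewrite nth_nil (ltn_eqF lm).
  - by rewrite /w add1n prednK 1?ltnW // m0 m1 eqxx.
  - rewrite nth_nil /w !addSn !eqSS /=.
    by rewrite (_ : (_ == m) = false) //; apply/eqP; lia.
rewrite (hassoc i0 i1) => -[v vP vz]; apply/coset_setP.
have v0 : v i0 = y by have /= := vP i0; rewrite /splice /=.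
have v1 : I (v i1).
  have /= := vP i1; rewrite /splice /= => /(hyperideal_add idI); apply.
  by move=> l; rewrite /w /=; do 3?case: ifP => // _; exact: hyperideal0.
exists (v i1) => //; suff -> : pad (hzero R) [:: y; v i1] = v by [].
apply/funext=> -[[|[|j]] jm] /=.
- by rewrite -v0; congr v; apply: val_inj.
- by congr v; apply: val_inj.
- have /= -> := vP (Ordinal jm).
  rewrite /splice /= nth_nil /w !addSn !eqSS /=.
  by rewrite (_ : (_ == m) = false) //; apply/eqP; lia.
Qed.

Lemma hyperideal_opp (a : R) : I a -> I (hopp a).
Proof.
move=> Ia; pose i1 : 'I_m := Ordinal m_gt1.
have [| |x Ix] := @hyperideal_solve _ _ _ _ idI i1 (pad (hzero R) [:: a]) (hzero R).
- by move=> [[|j] jm] //= _; rewrite nth_nil; exact: hyperideal0.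
- exact: hyperideal0.
- rewrite (_ : upd _ _ _ = pad (hzero R) [:: a; x]) => [/hoppE-> //|].
  by apply/funext=> -[[|[|j]] jm] /=; rewrite /upd //= nth_nil.
Qed.

Lemma coset_set_sym (x y : R) : coset_set I y x -> coset_set I x y.
Proof.
move=> /coset_setP[a Ia yax]; apply/coset_setP.
pose i0 : 'I_m := Ordinal (ltnW m_gt1).
have := canonical_reversible addR i0 yax => /=.
set v := pad _ _; suff -> : v = pad (hzero R) [:: x; hopp a].
  by exists (hopp a) => //; exact: hyperideal_opp.
apply/funext; rewrite /v => -[[|j] jm] //=.
have -> : [seq hinv (hadd R) (hzero R) (nth (hzero R) [:: y; a] l)
            | l : 'I_m <- enum 'I_m & l != i0] =
          [seq hopp (nth (hzero R) [:: y; a] l) | l <- iota 1 m.-1].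
  rewrite (_ : iota 1 m.-1 = [seq val l | l : 'I_m <- enum 'I_m & l != i0]).
    by rewrite -map_comp.
  rewrite (_ : map _ _ = [seq k <- [seq val l | l <- enum 'I_m] | k != 0]).
    2: by rewrite [RHS]filter_map.
  rewrite val_enum_ord.
  rewrite -{2}(prednK (ltnW m_gt1)) /= (@eq_in_filter _ _ predT) ?filter_predT //.
  by move=> k; rewrite mem_iota => /andP[+ _]; case: k.
rewrite (nth_map 0) ?size_iota; last by lia.
rewrite nth_iota; last by lia.
by case: j jm => [|j] _ //=; rewrite !nth_nil hopp0.
Qed.

Lemma coset_set_refl (x : R) : coset_set I x x.
Proof.
apply/coset_setP; exists (hzero R); first exact: hyperideal0.
by rewrite pad_x0 hadd_x0.
Qed.

Lemma coset_eqP (x y : R) : coset I x = coset I y <-> coset_set I y x.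
Proof.
split=> [/(congr1 sval) /= <-|xy]; first exact: coset_set_refl.
apply: eq_exist; apply/seteqP; split; apply: coset_set_sub => //.
exact: coset_set_sym.
Qed.

Lemma coset_mul_upd (a : 'I_n -> R) (i : 'I_n) (x y : R) :
  coset I x = coset I y ->
  coset I (hmul R (upd a i x)) = coset I (hmul R (upd a i y)).
Proof.
move=> /coset_eqP/coset_setP[c Ic ycx]; apply/coset_eqP/coset_setP.
exists (hmul R (upd a i c)); first exact: hyperideal_mul.
have /= := krasner_distr krR a i (pad (hzero R) [:: y; c]).
move=> /seteqP[/(_ _ (imageP _ ycx)) + _].
rewrite (_ : (fun _ => _) = pad (hzero R)
  [:: hmul R (upd a i y); hmul R (upd a i c)]) //.
apply/funext=> -[[|[|j]] jm] //=; rewrite !nth_nil (krasner_mul0 krR) //.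
by exists i; rewrite /upd eqxx.
Qed.

Lemma coset_mul (r s : 'I_n -> R) : (forall j, coset I (r j) = coset I (s j)) ->
  coset I (hmul R r) = coset I (hmul R s).
Proof.
move=> rs; pose h k : 'I_n -> R := fun j => if j < k then s j else r j.
have hE k : k <= n -> coset I (hmul R (h k)) = coset I (hmul R r).
  elim: k => [_|k IHk kn]; first by congr (coset I (hmul R _)); apply/funext.
  rewrite -(IHk (ltnW kn)); pose i := Ordinal kn.
  have -> : h k.+1 = upd (h k) i (s i).
    apply/funext=> j; rewrite /h /upd ltnS leq_eqVlt -val_eqE /=.
    by case: eqP => //= jk; rewrite (_ : j = i) //; apply: val_inj.
  have {2}-> : h k = upd (h k) i (r i).
    apply/funext=> j; rewrite /upd; case: eqP => [->|//].
    by rewrite /h ltnn.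
  exact/coset_mul_upd/esym.
rewrite -(hE n) //; congr (coset I (hmul R _)).
by apply/funext=> j; rewrite /h ltn_ord.
Qed.

Lemma coset_reprK (X : quot I) : coset I (coset_repr X) = X.
Proof.
case: X => A eA; apply: eq_exist; rewrite /coset_repr.
by case: cid => r /= <-.
Qed.

Lemma hmul_coset (r : 'I_n -> R) :
  hmul (quot I) (fun j => coset I (r j)) = coset I (hmul R r).
Proof. by apply: coset_mul => j; rewrite coset_reprK. Qed.

End QuotientTheory.

Record multset (m n : nat) (R : hyperalg m n) := MultSet {
  mset :> set R;
  msetM : forall s : 'I_n -> R, (forall j, mset (s j)) -> mset (hmul R s);
  mset1 : mset (hone R)
}.

Definition quot_mset (m n : nat) (R : hyperalg m n) (I S : set R) :
  set (quot I) := [set X | exists2 s, S s & X = coset I s].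

Lemma quot_msetM (m n : nat) (R : hyperalg m n) (I : set R) (S : multset R)
    (m_gt1 : 1 < m) (n_gt1 : 1 < n) (krR : krasner_hyperring R)
    (idI : hyperideal I) (X : 'I_n -> quot I) :
  (forall j, quot_mset S (X j)) -> quot_mset S (hmul (quot I) X).
Proof.
move=> /(_ _)/cid2-/all_sig2[s Ss Xs]; exists (hmul R s); first exact: msetM.
by rewrite -hmul_coset //; apply: (congr1 (hmul (quot I))); apply/funext.
Qed.

Lemma quot_mset1 (m n : nat) (R : hyperalg m n) (I : set R) (S : multset R) :
  @quot_mset m n R I S (hone (quot I)).
Proof. by exists (hone R) => //; exact: mset1. Qed.

Definition quot_multset (m n : nat) (R : hyperalg m n) (m_gt1 : 1 < m)
    (n_gt1 : 1 < n) (krR : krasner_hyperring R) (I : set R)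
    (idI : hyperideal I) (S : multset R) : multset (quot I) :=
  MultSet (fun X => @quot_msetM m n R I S m_gt1 n_gt1 krR idI X)
          (@quot_mset1 m n R I S).

(* The product of the elements of s and as many 1's as needed to fill the    *)
(* arguments of the operation, which is iterated from the left if            *)
(* n < size s.  For n > 1 the fuel size s + 1 is never exhausted.            *)
Fixpoint iter_mul (m n : nat) (R : hyperalg m n) (fuel : nat) (s : seq R) : R :=
  if fuel is fuel'.+1 then
    if size s <= n then hmul R (pad (hone R) s)
    else iter_mul fuel' (hmul R (pad (hone R) (take n s)) :: drop n s)
  else hone R.

Definition padded_mul (m n : nat) (R : hyperalg m n) (s : seq R) : R :=
  iter_mul (size s).+1 s.

Section Fractions.
Variables (m n : nat) (R : hyperalg m n) (S : multset R).

Definition den : Type := {s : R | mset S s}.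

Definition frac_equiv (p q : R * den) : Prop :=
  exists2 t, mset S t & exists2 y,
    hadd R (pad (hzero R)
      [:: hmul R (pad (hone R) [:: p.1; sval q.2]);
          hopp (hmul R (pad (hone R) [:: q.1; sval p.2]))]) y &
    hmul R (pad (hone R) [:: t; y]) = hzero R.

Definition frac_sort : Type :=
  {X : set (R * den) | exists p, X = [set q | frac_equiv p q]}.

Definition frac (r : R) (s : den) : frac_sort :=
  exist _ [set q | frac_equiv (r, s) q] (ex_intro _ (r, s) erefl).

Definition frac_repr (X : frac_sort) : R * den := sval (cid (svalP X)).

Definition den1 : den := exist _ (hone R) (mset1 S).

Definition den_mul (s : 'I_n -> den) : den :=
  exist _ (hmul R (fun j => sval (s j))) (msetM (fun j => svalP (s j))).

Definition fractions : hyperalg m n := {|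
  hsort := frac_sort;
  hadd := fun X => [set Y | exists (r : 'I_m -> R) (s : 'I_m -> den),
    (forall j, X j = frac (r j) (s j)) /\
    exists (y : R) (t : den),
      [/\ hadd R (fun j => padded_mul
            [seq upd (fun l => sval (s l)) j (r j) l | l <- enum 'I_m]) y,
          sval t = padded_mul [seq sval (s l) | l <- enum 'I_m] &
          Y = frac y t]];
  hmul := fun X => frac (hmul R (fun j => (frac_repr (X j)).1))
                        (den_mul (fun j => (frac_repr (X j)).2));
  hzero := frac (hzero R) den1;
  hone := frac (hone R) den1
|}.

Definition frac_ideal (I : set R) : set fractions :=
  [set X | exists (a : R) (s : den), I a /\ X = frac a s].

End Fractions.

Arguments frac_ideal {m n R} S I _.

(* Main.v *)
From HB Require Import structures.
Require Import Defs.
From mathcomp Require Import all_boot perm zify.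
From mathcomp Require Import boolp classical_sets.

(* Both sides are quotients of the set of pairs (r, s) with s in S: the left
   one through (r + I) / (s + I), the right one through r/s + S^-1 I.  In both,
   (r, s) and (r', s') are identified exactly when t r s' and t r' s are
   congruent modulo I for some t in S, and in both the operations are induced
   by the same operations on pairs.

   Uniqueness of the neutral element of the addition may fail in R/I, so the
   theory of Krasner hyperrings is not available for every hyperalgebra in play.
   The equality of fractions over R and over R/I only depends on two facts: the
   multiplication is that of a commutative monoid, and 0 is in t (a - b) iff
   t a = t b.

   A symmetric associative n-ary operation with a neutral element is the n-fold
   iterate of a commutative monoid law, which gives access to big operators;
   this also applies to the extension of the hyperaddition to sets. *)

Set Implicit Arguments.
Unset Strict Implicit.
Unset Printing Implicit Defensive.

Local Open Scope classical_set_scope.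

(** * Symmetric associative n-ary operations as commutative monoids *)

Record nary_monoid (k : nat) (T : Type) (h : ('I_k -> T) -> T) (u : T) : Prop :=
  NaryMonoid {
  nary_assoc : op_associative h;
  nary_sym : symmetric_op h;
  nary_unit : forall x, h (pad u [:: x]) = x
}.

Definition nary_bin (k : nat) (T : Type) (h : ('I_k -> T) -> T) (u x y : T) : T :=
  h (pad u [:: x; y]).

Lemma pad_rcons_unit k T (e : T) s : pad e (rcons s e) = pad e s :> ('I_k -> T).
Proof.
apply/funext=> j /=; rewrite nth_rcons.
by case: ltngtP => // sj; rewrite nth_default // ?sj // ltnW.
Qed.

Section NaryMonoid.
Variables (k : nat) (k_gt1 : 1 < k) (T : Type) (h : ('I_k -> T) -> T) (u : T).
Hypothesis hP : nary_monoid h u.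

Let i0 : 'I_k := Ordinal (ltnW k_gt1).
Let i1 : 'I_k := Ordinal k_gt1.

(** Since arguments can be permuted, associativity is only needed between positions 0 and 1.
    Conditions on plain numbers let later case analyses on the index compute. *)
Lemma nary_shift (w : nat -> T) :
  h (fun j => if j == 0 :> nat then h (fun l => w l) else w (j + k.-1)) =
  h (fun j => if j == 0 :> nat then w 0 else
              if j == 1 :> nat then h (fun l => w l.+1) else w (j + k.-1)).
Proof.
have := nary_assoc hP i0 i1 w; rewrite /splice /=.
have -> : (fun l : 'I_k => w (0 + l)) = (fun l => w l).
  by apply/funext=> l; rewrite add0n.
have -> : (fun l : 'I_k => w (1 + l)) = (fun l => w l.+1).
  by apply/funext=> l; rewrite add1n.
move=> e; transitivity (h (fun j => if j == i0 then h (fun l => w l)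
                                    else w (j + k.-1))).
  by congr h; apply/funext=> j; rewrite -val_eqE.
rewrite e; congr h; apply/funext=> -[[|[|j]] jk] //=.
Qed.

(** Apply [nary_shift] to [x :: s] continued by units: the inner product on the left absorbs the
    whole list, the one on the right absorbs [s]. *)
Lemma nary_pad_cons x s : size s < k ->
  h (pad u (x :: s)) = nary_bin h u x (h (pad u s)).
Proof.
move=> sk; have := nary_shift (nth u (x :: s)).
set a := h _; set b := h _ => e; transitivity a; last rewrite e.
  rewrite /a -[LHS](nary_unit hP); congr h.
  apply/funext=> -[[|j] jk] //=; rewrite nth_nil nth_default //; lia.
rewrite /b /nary_bin; congr h; apply/funext=> -[[|[|j]] jk] //=.
by rewrite nth_nil nth_default //; lia.
Qed.

Lemma nary_binC : commutative (nary_bin h u).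
Proof.
move=> x y; rewrite /nary_bin -(nary_sym hP (tperm i0 i1)); congr h.
apply/funext=> j; rewrite /=; case: tpermP => [->|->|] //.
by case: j => -[|[|j]] jk /= /eqP + /eqP; rewrite -!val_eqE //= !nth_nil.
Qed.

Lemma nary_bin1 x : nary_bin h u x u = x.
Proof. by rewrite /nary_bin (pad_rcons_unit _ u [:: x]) (nary_unit hP). Qed.

Lemma nary_bin1l x : nary_bin h u u x = x.
Proof. by rewrite nary_binC nary_bin1. Qed.

Lemma nary_binA : associative (nary_bin h u).
Proof.
(* The sequence is x, y, u, ..., u, z with z in place [k], just past the first inner product, so one
   bracketing yields (xy)z. *)
move=> x y z; pose w l := if l == k then z else nth u [:: x; y] l.
have := nary_shift w; set a := h _; set b := h _ => e.
have -> : nary_bin h u (nary_bin h u x y) z = a.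
  congr h; apply/funext=> -[[|[|j]] jk] //=.
  - by congr h; apply/funext=> l; rewrite /w (ltn_eqF (ltn_ord l)).
  - by rewrite /w add1n prednK ?eqxx // ltnW.
  - rewrite /w addSn /= !nth_nil ifF // ?addSn /= ?nth_nil //; lia.
rewrite e; congr h; apply/funext=> -[[|[|j]] jk] //=.
- by rewrite /w /= ifF //; lia.
- have k1 : k.-1 < k by lia.
  pose il := Ordinal k1.
  (* In the other bracketing z is last in the inner product; the transposition brings it next to
     y. *)
  rewrite -(nary_sym hP (tperm i1 il)); congr h; apply/funext=> l /=.
  rewrite /w; case: tpermP => [->|->|] /=.
  + by rewrite prednK ?eqxx // ltnW.
  + case: eqP => [<- //|k2]; rewrite nth_default //=; lia.
  + case: l => -[|[|l]] lk //=.
    * by rewrite ifF //; lia.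
    * by move/eqP; rewrite -val_eqE.
    * move=> _ /eqP; rewrite -val_eqE /= !nth_nil => ?; rewrite ifF //; lia.
- rewrite /w addSn /= !nth_nil ifF // ?addSn /= ?nth_nil //; lia.
Qed.

#[local] HB.instance Definition _ :=
  Monoid.isComLaw.Build T u (nary_bin h u) nary_binA nary_binC nary_bin1l.

Lemma nary_pad_big s : size s <= k -> h (pad u s) = \big[nary_bin h u/u]_(x <- s) x.
Proof.
elim: s => [_|x s IHs sk]; last by rewrite nary_pad_cons // IHs ?big_cons // ltnW.
by rewrite big_nil -(pad_rcons_unit _ u [::]) (nary_unit hP).
Qed.

Lemma nary_big x : h x = \big[nary_bin h u/u]_j x j.
Proof.
have {1}-> : x = pad u [seq x j | j <- enum 'I_k].
  by apply/funext=> j /=; rewrite (nth_map j) ?nth_ord_enum // size_enum_ord.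
rewrite nary_pad_big; last by rewrite size_map size_enum_ord.
by rewrite big_map_id big_enum.
Qed.

End NaryMonoid.

(** * Extension of a hyperoperation to sets *)

Section SetExtension.
Variables (k : nat) (k_gt1 : 1 < k) (T : Type) (f : ('I_k -> T) -> set T) (e : T).

Lemma hext_set1 x : hext f (fun j => [set x j]) = f x.
Proof.
apply/seteqP; split=> [y [v vx]|y fxy]; last by exists x.
by rewrite (_ : v = x) //; apply/funext=> j; exact: vx.
Qed.

Lemma hext_sym : symmetric_op f -> symmetric_op (hext f).
Proof.
move=> fC s A; apply/seteqP; split=> z [x xA xz].
  exists (fun j => x (s^-1%g j)).
    by move=> j; have := xA (s^-1%g j); rewrite permKV.
  rewrite -(fC s); rewrite (_ : (fun _ => _) = x) //.
  by apply/funext=> j; rewrite permK.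
by exists (fun j => x (s j)); rewrite ?fC // => j; exact: xA.
Qed.

(* An element of the iterated sum only depends on one choice of representatives
   of the first 2k-1 sets, which is what reduces the claim to singletons. *)
Lemma hext_assoc : hyper_associative f -> op_associative (hext f).
Proof.
move=> fA i j X.
have E (l : 'I_k) z :
    hext f (splice l X (hext f (fun p : 'I_k => X (l + p)))) z <->
    exists2 x : nat -> T, (forall p, p < k.*2.-1 -> X p (x p)) &
      hext f (splice l (fun p => [set x p]) (f (fun p : 'I_k => x (l + p)))) z.
  split=> [[v vX vz]|[x xX [v vx vz]]]; last first.
    exists v => // p; have := vx p; rewrite /splice.
    case: ifP => [pl ->|]; first by apply: xX; have := ltn_ord p; lia.
    case: eqP => [_ _ vp|/eqP + _ ->].
      exists (fun p : 'I_k => x (l + p)) => // q; apply: xX.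
      by have := ltn_ord q; have := ltn_ord l; lia.
    by move=> _; apply: xX; have := ltn_ord p; lia.
  have := vX l; rewrite /splice ltnn eqxx => -[w wX wv].
  (* The sequence is reassembled from the outer tuple [v] and the inner tuple [w]; the default [v l]
     is never read below place 2k-1. *)
  pose ext (a : 'I_k -> T) p := oapp a (v l) (insub p).
  have extE a (p : 'I_k) : ext a p = a p by rewrite /ext valK.
  exists (fun p => if p < l then ext v p else if p < l + k then ext w (p - l)
                   else ext v (p - k.-1)).
    move=> p pk; case: ltnP => [pl|lp].
      have := vX (Ordinal (ltn_trans pl (ltn_ord l))).
      by rewrite /splice /= pl -extE.
    case: ltnP => plk.
      have pk' : p - l < k by lia.
      by have := wX (Ordinal pk'); rewrite -extE /= subnKC.
    have pk' : p - k.-1 < k by lia.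
    have := vX (Ordinal pk'); rewrite /splice -extE -val_eqE /=.
    by rewrite !ifF ?subnK //; lia.
  exists v => // p; rewrite /splice -val_eqE /=.
  case: ltngtP => [pl|lp|pl]; first by rewrite extE.
    rewrite !ifF; [|lia|lia].
    by rewrite addnK extE.
  rewrite (_ : p = l); last exact: val_inj.
  rewrite (_ : (fun _ => _) = w) //; apply/funext=> q.
  by rewrite ltnNge leq_addr /= ltn_add2l ltn_ord addKn extE.
apply/seteqP; split=> z /E[x xX xz]; apply/E; exists x => //.
  by rewrite -(fA i j).
by rewrite (fA i j).
Qed.

Hypothesis fP : canonical_hypergroup f e.

Lemma hext_pad1 A : hext f (pad [set e] [:: A]) = A.
Proof.
have f1 x : f (pad e [:: x]) = [set x] by case: (canonical_unit fP) => + _; apply.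
pose i0 : 'I_k := Ordinal (ltnW k_gt1).
apply/seteqP; split=> z.
  move=> [x xA]; rewrite (_ : x = pad e [:: x i0]); last first.
    apply/funext=> -[[|j] jk] /=; first by congr x; exact: val_inj.
    by have := xA (Ordinal jk); rewrite /= !nth_nil => ->.
  by rewrite f1 => ->; exact: xA i0.
move=> Az; exists (pad e [:: z]); last by rewrite f1.
by move=> [[|j] jk] //=; rewrite !nth_nil.
Qed.

Lemma bin_hextP A B z : nary_bin (hext f) [set e] A B z <->
  exists2 a, A a & exists2 b, B b & f (pad e [:: a; b]) z.
Proof.
pose i0 : 'I_k := Ordinal (ltnW k_gt1); pose i1 : 'I_k := Ordinal k_gt1.
split=> [[x xAB xz]|[a Aa [b Bb abz]]]; last first.
  by exists (pad e [:: a; b]) => // -[[|[|j]] jk] //=; rewrite !nth_nil.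
exists (x i0); first exact: xAB i0.
exists (x i1); first exact: xAB i1.
rewrite (_ : pad e _ = x) //.
apply/funext=> -[[|[|j]] jk] /=; first by congr x; exact: val_inj.
  by congr x; exact: val_inj.
by have := xAB (Ordinal jk); rewrite /= !nth_nil => ->.
Qed.

Lemma bin_hext_set1 a b :
  nary_bin (hext f) [set e] [set a] [set b] = f (pad e [:: a; b]).
Proof.
apply/seteqP; split=> z; first by move=> /bin_hextP[_ -> [_ ->]].
by move=> abz; apply/bin_hextP; exists a => //; exists b.
Qed.

Lemma nary_monoid_hext : nary_monoid (hext f) [set e].
Proof.
split; last exact: hext_pad1.
- by apply: hext_assoc; case: (canonical_hypergroupP fP).
- exact/hext_sym/(canonical_symmetric fP).
Qed.

End SetExtension.

(** * Arithmetic of the quotient by a hyperideal *)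

Section HyperringQuotient.
Variables (m n : nat) (m_gt1 : 1 < m) (n_gt1 : 1 < n) (R : hyperalg m n).
Hypotheses (krR : krasner_hyperring R) (mulC : symmetric_op (hmul R)).
Hypothesis R1 : scalar_identity (hone R).
Variable I : set R.
Hypothesis idI : hyperideal I.

Let addR := krasner_add krR.
Let cosetP := coset_eqP m_gt1 n_gt1 krR idI.
Let addsP := nary_monoid_hext m_gt1 addR.
Local Notation adds := (nary_bin (hext (hadd R)) [set hzero R]).
Local Notation "A \+ B" := (adds A B).

#[local] HB.instance Definition _ := Monoid.isComLaw.Build (set R) [set hzero R]
  adds (nary_binA m_gt1 addsP) (nary_binC m_gt1 addsP) (nary_bin1l m_gt1 addsP).

Lemma nary_monoid_hmul : nary_monoid (hmul R) (hone R).
Proof. by split=> //; exact: krasner_mulA krR. Qed.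

Local Notation "x * y" := (nary_bin (hmul R) (hone R) x y).

(** Each r_j lies in z_j + I. The monoid law on sets regroups the sum of the sets z_j + I as the sum
    of the z_j plus a sum of copies of I, and the latter is contained in I. *)
Lemma hadd_coset (r z : 'I_m -> R) (y : R) :
  (forall j, coset I (r j) = coset I (z j)) -> hadd R r y ->
  exists2 y', hadd R z y' & coset I y = coset I y'.
Proof.
move=> rz ry.
have : hext (hadd R) (fun j => [set z j] \+ I) y.
  by exists r => // j; apply/cosetP.
rewrite (nary_big m_gt1 addsP) big_split -!(nary_big m_gt1 addsP) hext_set1.
move=> /(bin_hextP m_gt1)[y' zy' [b Ib yb]]; exists y' => //.
apply/cosetP/(bin_hextP m_gt1); exists y' => //; exists b => //.
by case: Ib => v /(hyperideal_add idI); apply.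
Qed.

Lemma hadd_quot (z : 'I_m -> R) (Y : quot I) :
  hadd (quot I) (fun j => coset I (z j)) Y <->
  exists2 y, hadd R z y & Y = coset I y.
Proof.
split=> [[r rz [y ry ->]]|[y zy ->]]; last by exists z => //; exists y.
have [y' zy' ->] := hadd_coset (fun j => esym (rz j)) ry.
by exists y'.
Qed.

Lemma hadd_mul (t : R) (x : 'I_m -> R) :
  [set t * y | y in hadd R x] = hadd R (fun j => t * x j).
Proof.
pose i1 : 'I_n := Ordinal n_gt1.
have E y : t * y = hmul R (upd (pad (hone R) [:: t]) i1 y).
  rewrite /nary_bin; congr hmul; apply/funext=> -[[|[|j]] jn] //=.
  by rewrite /upd -val_eqE /= !nth_nil.
rewrite (_ : (fun j => t * x j) =
    fun j => hmul R (upd (pad (hone R) [:: t]) i1 (x j))); last exact/funext.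
by rewrite -(krasner_distr krR); apply: eq_imagel => y _; exact: E.
Qed.

Lemma bin_hmul0 t : t * hzero R = hzero R.
Proof. by apply: (krasner_mul0 krR); exists (Ordinal n_gt1). Qed.

Lemma hmul_hopp t x : t * hopp x = hopp (t * x).
Proof.
apply/esym/(hoppE krR).
have : hadd R (fun j => t * pad (hzero R) [:: x; hopp x] j) (hzero R).
  rewrite -hadd_mul; exists (hzero R); first exact: hoppP.
  exact: bin_hmul0.
rewrite (_ : (fun _ => _) = pad (hzero R) [:: t * x; t * hopp x]) //.
by apply/funext=> -[[|[|j]] jm] //=; rewrite !nth_nil bin_hmul0.
Qed.

Lemma hadd_mul2 t a b :
  [set t * y | y in hadd R (pad (hzero R) [:: a; b])] =
  hadd R (pad (hzero R) [:: t * a; t * b]).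
Proof.
rewrite hadd_mul; congr hadd; apply/funext=> -[[|[|j]] jm] //=.
by rewrite !nth_nil bin_hmul0.
Qed.

Lemma hadd2C a b :
  hadd R (pad (hzero R) [:: a; b]) = hadd R (pad (hzero R) [:: b; a]).
Proof. by rewrite -!(bin_hext_set1 m_gt1) (nary_binC m_gt1 addsP). Qed.

Lemma hoppK (x : R) : hopp (hopp x) = x.
Proof. by apply/(hoppE krR); rewrite hadd2C; exact: hoppP. Qed.

(** By distributivity the left side says that 0 lies in ta - tb, and opposites in R are unique. *)
Lemma hmul_cancel (t a b : R) :
  (exists2 y, hadd R (pad (hzero R) [:: a; hopp b]) y & t * y = hzero R) <->
  t * a = t * b.
Proof.
transitivity (hadd R (pad (hzero R) [:: t * a; hopp (t * b)]) (hzero R)).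
  by rewrite -hmul_hopp -hadd_mul2.
split=> [/(hoppE krR) e|->]; last exact: hoppP.
by rewrite -[LHS]hoppK e hoppK.
Qed.

Lemma coset_eq0 (x : R) : coset I x = coset I (hzero R) <-> I x.
Proof.
rewrite cosetP (coset_setP I m_gt1).
have E (a : R) : hadd R (pad (hzero R) [:: hzero R; a]) = [set a].
  by rewrite hadd2C pad_x0 hadd_x0.
split=> [[a Ia]|Ix]; first by rewrite E => ->.
by exists x => //; rewrite E.
Qed.

(** This stands in for uniqueness of opposites modulo I: 0 lies in (b + c) - y = b + (c - y), so -b
    lies in c - y, hence in c + I. *)
Lemma coset_hopp (b c y : R) :
  hadd R (pad (hzero R) [:: b; c]) y -> I y -> coset I (hopp b) = coset I c.
Proof.
move=> bcy Iy.
have : adds (adds [set b] [set c]) [set hopp y] (hzero R).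
  apply/(bin_hextP m_gt1); exists y; first by rewrite bin_hext_set1.
  by exists (hopp y) => //; exact: hoppP.
rewrite -(nary_binA m_gt1 addsP) => /(bin_hextP m_gt1)[_ ->].
rewrite bin_hext_set1 // => -[w cyw /(hoppE krR) ->].
apply/cosetP/(coset_setP I m_gt1).
by exists (hopp y) => //; exact: (hyperideal_opp m_gt1 n_gt1 krR idI Iy).
Qed.

Lemma coset_pad k (e : R) s :
  pad (coset I e) [seq coset I x | x <- s] = (fun j : 'I_k => coset I (pad e s j)).
Proof.
apply/funext=> j /=; case: (ltnP j (size s)) => sj; first exact: nth_map.
by rewrite !nth_default ?size_map.
Qed.

Lemma hadd_quot2 (a b : R) (Y : quot I) :
  hadd (quot I) (pad (hzero (quot I)) [:: coset I a; coset I b]) Y <->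
  exists2 y, hadd R (pad (hzero R) [:: a; b]) y & Y = coset I y.
Proof. by rewrite (coset_pad m (hzero R) [:: a; b]) hadd_quot. Qed.

Lemma bin_coset (a b : R) :
  nary_bin (hmul (quot I)) (hone (quot I)) (coset I a) (coset I b) = coset I (a * b).
Proof.
rewrite /nary_bin (coset_pad n (hone R) [:: a; b]).
by rewrite (hmul_coset m_gt1 n_gt1 krR idI).
Qed.

(** In R/I, [hopp] picks some Y whose sum with b + I contains zero. Such a Y exists, and
    [coset_hopp] shows that every one is the coset of -b. *)
Lemma hopp_coset (b : R) : hopp (coset I b : quot I) = coset I (hopp b).
Proof.
rewrite /hopp /hinv; case: xgetP => [Y _|] /=; last first.
  move=> /(_ (coset I (hopp b))) []; apply/hadd_quot2.
  by exists (hzero R) => //; exact: hoppP.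
rewrite -[Y]coset_reprK => /hadd_quot2[y bY /esym/coset_eq0 Iy].
exact/esym/(coset_hopp bY).
Qed.

Lemma hmul_quot_cancel (T A B : quot I) :
  (exists2 Y, hadd (quot I) (pad (hzero (quot I)) [:: A; hopp B]) Y &
     nary_bin (hmul (quot I)) (hone (quot I)) T Y = hzero (quot I)) <->
  nary_bin (hmul (quot I)) (hone (quot I)) T A =
  nary_bin (hmul (quot I)) (hone (quot I)) T B.
Proof.
rewrite -[T]coset_reprK -[A]coset_reprK -[B]coset_reprK hopp_coset !bin_coset.
move: (coset_repr T) (coset_repr A) (coset_repr B) => t a b; split.
  move=> [Y /hadd_quot2[y aby ->]]; rewrite bin_coset => /coset_eq0 Ity.
  have : hadd R (pad (hzero R) [:: hopp (t * b); t * a]) (t * y).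
    by rewrite hadd2C -hmul_hopp -hadd_mul2; exists y.
  by move=> /coset_hopp/(_ Ity); rewrite hoppK.
move=> /esym/cosetP/(coset_setP I m_gt1)[c Ic acb].
(* As tb lies in ta + c, zero lies in (ta + c) - tb. Regrouped as (ta - tb) + c, this yields an
   element ty of ta - tb equal to -c, with y in a - b. *)
have : adds (adds [set t * a] [set c]) [set hopp (t * b)] (hzero R).
  apply/(bin_hextP m_gt1); exists (t * b); first by rewrite bin_hext_set1.
  by exists (hopp (t * b)) => //; exact: hoppP.
rewrite -(nary_binA m_gt1 addsP) (nary_binC m_gt1 addsP [set c]).
rewrite (nary_binA m_gt1 addsP).
move=> /(bin_hextP m_gt1)[w + [_ -> wc]].
rewrite bin_hext_set1 // -hmul_hopp -hadd_mul2 => -[y aby tyw].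
exists (coset I y); first by apply/hadd_quot2; exists y.
rewrite bin_coset; apply/coset_eq0; rewrite tyw -[w]hoppK (hoppE krR wc).
exact: (hyperideal_opp m_gt1 n_gt1 krR idI Ic).
Qed.

Lemma nary_monoid_quot : nary_monoid (hmul (quot I)) (hone (quot I)).
Proof.
have cM := hmul_coset m_gt1 n_gt1 krR idI.
split=> [i j X|s X|X].
- have E (l : 'I_n) :
      hmul (quot I) (splice l X (hmul (quot I) (fun p : 'I_n => X (l + p)))) =
      coset I (hmul R (splice l (fun p => coset_repr (X p))
        (hmul R (fun p : 'I_n => coset_repr (X (l + p)))))).
    rewrite -cM; congr hmul; apply/funext=> p; rewrite /splice.
    by case: ifP => _; [|case: ifP => _ //]; rewrite coset_reprK.
  by rewrite !E; congr (coset I _); exact: (krasner_mulA krR).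
- by rewrite /= (mulC s (fun j => coset_repr (X j))).
- rewrite -[X]coset_reprK (coset_pad n (hone R) [:: _]) cM.
  by rewrite -(R1 (coset_repr X)).
Qed.

End HyperringQuotient.

(** * Fractions over a multiplicative monoid with the cancellation criterion *)

Section FractionArithmetic.
Variables (m n : nat) (n_gt1 : 1 < n) (A : hyperalg m n).
Hypothesis mulP : nary_monoid (hmul A) (hone A).
Local Notation mul := (nary_bin (hmul A) (hone A)).
Local Notation "x * y" := (mul x y).
Hypothesis cancelP : forall t a b : A,
  (exists2 y, hadd A (pad (hzero A) [:: a; hopp b]) y & t * y = hzero A) <->
  t * a = t * b.
Variable S : multset A.

#[local] HB.instance Definition _ := Monoid.isComLaw.Build A (hone A)
  (nary_bin (hmul A) (hone A)) (nary_binA n_gt1 mulP) (nary_binC n_gt1 mulP)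
  (nary_bin1l n_gt1 mulP).

Lemma mset_bin x y : mset S x -> mset S y -> mset S (x * y).
Proof.
move=> Sx Sy; apply: msetM => -[[|[|j]] jn] //=; rewrite !nth_nil; exact: mset1.
Qed.

Lemma mset_big (J : finType) (P : pred J) (x : J -> A) :
  (forall j, mset S (x j)) -> mset S (\big[mul/hone A]_(j | P j) x j).
Proof.
move=> Sx; elim/big_ind: _ => [|y z|j _]; [exact: mset1 | exact: mset_bin | exact: Sx].
Qed.

Lemma padded_mulE (s : seq A) :
  padded_mul s = \big[mul/hone A]_(x <- s) x.
Proof.
suff iterE fuel : size s < fuel ->
    iter_mul fuel s = \big[mul/hone A]_(x <- s) x by exact: iterE.
elim: fuel s => [//|fuel IH] s; rewrite ltnS => sf /=; case: leqP => sn.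
  exact: nary_pad_big.
(* One pass removes [n] entries and puts one back, so the list shrinks because [n] exceeds 1. *)
rewrite IH /=; last by rewrite size_drop; lia.
rewrite big_cons (nary_pad_big n_gt1 mulP); last first.
  by rewrite size_take; case: ifP => //; lia.
by rewrite -big_cat cat_take_drop.
Qed.

Lemma frac_equivE (p q : A * den S) : frac_equiv p q <->
  exists2 t, mset S t & t * (p.1 * sval q.2) = t * (q.1 * sval p.2).
Proof. by split=> -[t St /cancelP tpq]; exists t. Qed.

Lemma frac_equiv_trans (p q r : A * den S) :
  frac_equiv p q -> frac_equiv q r -> frac_equiv p r.
Proof.
move=> /frac_equivE[t St tpq] /frac_equivE[t' St' tqr]; apply/frac_equivE.
(* The factor [sval q.2] allows the first equation to be applied; this makes [q.1 * sval r.2]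
   available for the second. *)
exists (t * t' * sval q.2).
  by apply: mset_bin; [exact: mset_bin | exact: svalP q.2].
rewrite [LHS]mul.[AC (3*2) ((1*(4*3))*(2*5))] tpq.
rewrite [LHS]mul.[AC ((1*2)*2) ((4*(2*5))*(1*3))] tqr.
by rewrite [LHS]mul.[AC ((1*2)*2) ((4*1*3)*(2*5))].
Qed.

Lemma frac_equiv_sym (p q : A * den S) : frac_equiv p q -> frac_equiv q p.
Proof. by move=> /frac_equivE[t St e]; apply/frac_equivE; exists t. Qed.

Lemma frac_equiv_refl (p : A * den S) : frac_equiv p p.
Proof. by apply/frac_equivE; exists (hone A) => //; exact: mset1. Qed.

Lemma frac_eqP (a b : A) (s t : den S) : frac a s = frac b t <->
  exists2 u, mset S u & u * (a * sval t) = u * (b * sval s).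
Proof.
rewrite -(frac_equivE (a, s) (b, t)); split=> [e|ab].
  suff : sval (frac a s) (b, t) by [].
  by rewrite e; exact: frac_equiv_refl.
apply: eq_exist; apply/seteqP; split=> q; apply: frac_equiv_trans => //.
exact: frac_equiv_sym.
Qed.

Lemma frac_reprK (X : fractions S) : frac (frac_repr X).1 (frac_repr X).2 = X.
Proof.
case: X => X eX; apply: eq_exist; rewrite /frac_repr.
by case: cid => -[a s] /= ->.
Qed.

(** The product in [fractions] is computed on chosen representatives. The multipliers relating them
    to the given ones multiply to a multiplier for the products. *)
Lemma hmul_frac (a : 'I_n -> A) (s : 'I_n -> den S) :
  hmul (fractions S) (fun j => frac (a j) (s j)) = frac (hmul A a) (den_mul s).
Proof.
apply/frac_eqP => /=; set p := fun j => frac_repr (frac (a j) (s j)).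
have /(_ _)/cid2-/all_sig2[t St tE] j :
    exists2 u, mset S u & u * ((p j).1 * sval (s j)) = u * (a j * sval (p j).2).
  by apply/frac_eqP; rewrite frac_reprK.
exists (hmul A t); first exact: msetM.
by rewrite !(nary_big n_gt1 mulP) -!big_split; apply: eq_bigr => j _; exact: tE.
Qed.

Definition numerator (p : 'I_m -> A * den S) (j : 'I_m) : A :=
  (p j).1 * \big[mul/hone A]_(l | l != j) sval (p l).2.

Definition denominator (p : 'I_m -> A * den S) : A :=
  \big[mul/hone A]_l sval (p l).2.

Lemma hadd_fractions (X : 'I_m -> fractions S) (Y : fractions S) :
  hadd (fractions S) X Y <->
  exists2 p : 'I_m -> A * den S, (forall j, X j = frac (p j).1 (p j).2) &
  exists2 q : A * den S, hadd A (numerator p) q.1 /\ sval q.2 = denominator p &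
    Y = frac q.1 q.2.
Proof.
have numE (p : 'I_m -> A * den S) : (fun j => padded_mul
    [seq upd (fun l => sval (p l).2) j (p j).1 l | l <- enum 'I_m]) = numerator p.
  apply/funext=> j; rewrite padded_mulE big_map_id big_enum (bigD1 j) //= /upd eqxx.
  by congr (_ * _); apply: eq_bigr => l /negPf ->.
have denE (p : 'I_m -> A * den S) :
    padded_mul [seq sval (p l).2 | l <- enum 'I_m] = denominator p.
  by rewrite padded_mulE big_map_id big_enum.
split=> [[r [s [Xrs [y [t [ry tE ->]]]]]]|[p Xp [q [py qE] ->]]].
  exists (fun j => (r j, s j)) => //; exists (y, t) => //=.
  by rewrite -numE -denE.
exists (fun j => (p j).1), (fun j => (p j).2); split => //.
by exists q.1, q.2; rewrite numE denE.
Qed.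

End FractionArithmetic.

(** The isomorphism sends x to the [pb]-image of any [pa]-preimage of x; equal kernels make this
    well defined and bijective. [add] is a relation and need not respect the kernels, as the sums
    quantify over all representatives. *)
Lemma presented_isomorphic (m n : nat) (A B : hyperalg m n) (P : Type)
    (pa : P -> A) (pb : P -> B)
    (add : ('I_m -> P) -> P -> Prop) (mul : ('I_n -> P) -> P) :
  (forall x, exists p, pa p = x) -> (forall y, exists p, pb p = y) ->
  (forall p q, pb p = pb q <-> pa p = pa q) ->
  (forall x y, hadd A x y <-> exists2 p, (forall j, x j = pa (p j)) &
    exists2 q, add p q & y = pa q) ->
  (forall x y, hadd B x y <-> exists2 p, (forall j, x j = pb (p j)) &
    exists2 q, add p q & y = pb q) ->
  (forall p, hmul A (fun j => pa (p j)) = pa (mul p)) ->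
  (forall p, hmul B (fun j => pb (p j)) = pb (mul p)) ->
  isomorphic A B.
Proof.
move=> /(_ _)/cid-/all_sig[ra raK]
  /(_ _)/cid-/all_sig[rb rbK] pE addA addB mulA mulB.
exists (fun x => pb (ra x)).
have psiE p : pb (ra (pa p)) = pb p by apply/pE.
split; [|split].
- by exists (fun y => pa (rb y)) => x; [rewrite -[RHS]raK; apply/pE|];
    rewrite ?psiE rbK.
- move=> x; apply/seteqP; split=> [_ [y /addA[p xp [q pq ->]] <-]|y].
    apply/addB; exists p => [j|]; first by rewrite xp psiE.
    by exists q; rewrite ?psiE.
  move=> /addB[p xp [q pq ->]]; exists (pa q); last exact: psiE.
  apply/addA; exists p; last by exists q.
  by move=> j; rewrite -[LHS]raK; apply/pE; rewrite xp.
- move=> x; have {1}-> : x = fun j => pa (ra (x j)) by apply/funext=> j; rewrite raK.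
  by rewrite mulA psiE mulB.
Qed.

(** * Two presentations by pairs (r, s) *)

Section FractionsOfQuotient.
Variables (m n : nat) (m_gt1 : 1 < m) (n_gt1 : 1 < n) (R : hyperalg m n).
Hypotheses (krR : krasner_hyperring R) (mulC : symmetric_op (hmul R)).
Hypothesis R1 : scalar_identity (hone R).
Variables (S : multset R) (I : set R).
Hypothesis idI : hyperideal I.

Let mulRP := nary_monoid_hmul krR mulC R1.
Let mulQP := nary_monoid_quot m_gt1 n_gt1 krR mulC R1 idI.
Let cancelR := hmul_cancel m_gt1 n_gt1 krR.
Let cancelQ := hmul_quot_cancel m_gt1 n_gt1 krR idI.
Let bin_cosetE := bin_coset m_gt1 n_gt1 krR idI.

Local Notation mul := (nary_bin (hmul R) (hone R)).
Local Notation "x * y" := (mul x y).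

#[local] HB.instance Definition _ := Monoid.isComLaw.Build R (hone R)
  mul (nary_binA n_gt1 mulRP) (nary_binC n_gt1 mulRP) (nary_bin1l n_gt1 mulRP).

Local Notation Sbar := (quot_multset m_gt1 n_gt1 krR idI S).
Local Notation SI := (frac_ideal S I).

Definition den_coset (s : den S) : den Sbar :=
  exist _ (coset I (sval s) : quot I) (ex_intro2 _ _ (sval s) (svalP s) erefl).

Definition quot_frac (p : R * den S) : fractions Sbar :=
  frac (coset I p.1 : quot I) (den_coset p.2).

Definition frac_quot (p : R * den S) : quot SI :=
  coset SI (frac p.1 p.2 : fractions S).

Lemma den_coset_surj (d : den Sbar) : exists s, den_coset s = d.
Proof. by case: d => T [t St eT]; exists (exist _ t St); exact: eq_exist. Qed.

Lemma quot_frac_surj X : exists p, quot_frac p = X.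
Proof.
rewrite -(frac_reprK X); case: (frac_repr X) => r d /=.
have [s <-] := den_coset_surj d.
by exists (coset_repr r, s); rewrite /quot_frac coset_reprK.
Qed.

Lemma frac_quot_surj Y : exists p, frac_quot p = Y.
Proof.
rewrite -(coset_reprK Y); exists (frac_repr (coset_repr Y)).
by rewrite /frac_quot frac_reprK.
Qed.

Lemma quot_frac_eqP (p q : R * den S) : quot_frac p = quot_frac q <->
  exists2 t, mset S t &
    coset I (t * (p.1 * sval q.2)) = coset I (t * (q.1 * sval p.2)).
Proof.
have denE s : sval (den_coset s) = coset I (sval s) by [].
rewrite /quot_frac (frac_eqP n_gt1 mulQP cancelQ); split=> [[T [t St ->]]|[t St e]].
  by rewrite !denE !bin_cosetE => e; exists t.
by exists (coset I t); [exists t | rewrite !denE !bin_cosetE].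
Qed.

Lemma quot_frac_frac (p q : R * den S) :
  frac p.1 p.2 = frac q.1 q.2 -> quot_frac p = quot_frac q.
Proof.
move=> /(frac_eqP n_gt1 mulRP cancelR)[t St e].
by apply/quot_frac_eqP; exists t => //; rewrite e.
Qed.

Lemma hyperideal_bin (b a : R) : I a -> I (b * a).
Proof.
move=> Ia; have := hyperideal_mul idI (pad (hone R) [:: b]) (Ordinal n_gt1) Ia.
rewrite (_ : upd _ _ _ = pad (hone R) [:: b; a]) //.
by apply/funext=> -[[|[|j]] jn] //=; rewrite /upd -val_eqE /= !nth_nil.
Qed.

(** An element of p + S^-1 I is a sum of m fractions, all but the first in S^-1 I. A common
    multiplier from S sends the other numerators into I, so modulo I only the first term remains. *)
Lemma coset_frac_sub (p q : R * den S) :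
  coset_set SI (frac p.1 p.2 : fractions S) (frac q.1 q.2) ->
  quot_frac q = quot_frac p.
Proof.
pose i0 : 'I_m := Ordinal (ltnW m_gt1).
move=> [x xP /(hadd_fractions n_gt1 mulRP)[P xE [z [numz denz] /quot_frac_frac->]]].
have /quot_frac_frac-> : frac p.1 p.2 = frac (P i0).1 (P i0).2.
  by rewrite -xE; apply: esym; exact: xP i0.
(* A representative of an element of S^-1 I need not have its numerator in I, but some multiple of
   that numerator by an element of S lies in I. The padding zeros count as 0/1. *)
have /(_ _)/cid2-/all_sig2[v Sv Iv] j :
    exists2 u, mset S u & j != i0 -> I (u * (P j).1).
  have [->|ji0] := eqVneq j i0; first by exists (hone R) => //; exact: mset1.
  have [a [s [Ia]]] : SI (x j).
    have I0 := hyperideal0 n_gt1 krR idI.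
    have := xP j; case: j ji0 => -[|[|j]] jm //= _; rewrite nth_nil => ->.
    by exists (hzero R), (den1 S).
  rewrite xE => /(frac_eqP n_gt1 mulRP cancelR)[u Su e].
  exists (u * sval s); first by apply: mset_bin => //; exact: svalP.
  move=> _; rewrite [X in I X]mul.[ACl 1*(3*2)] e mul.[AC (1*2) (1*3*2)].
  exact: hyperideal_bin.
pose V := \big[mul/hone R]_j v j.
apply/quot_frac_eqP; exists V; first exact: mset_big.
have VE : coset I (V * z.1) = coset I (V * numerator P i0).
  have : [set V * y | y in hadd R (numerator P)] (V * z.1) by exists z.1.
  rewrite (hadd_mul n_gt1 krR).
  (* Modulo I the scaled numerators form a single term padded with zeros, whose sum is a
     singleton. *)
  have rz j : coset I (V * numerator P j) =
              coset I (pad (hzero R) [:: V * numerator P i0] j).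
    have [->|ji0] := eqVneq j i0; first by [].
    transitivity (coset I (hzero R)).
      apply/(coset_eq0 m_gt1 n_gt1 krR idI).
      rewrite /V /numerator (bigD1 j) //= [X in I X]mul.[AC (2*2) (2*4*(1*3))].
      exact/hyperideal_bin/Iv.
    by case: j ji0 => -[|j] jm //= _; rewrite nth_nil.
  move=> /(hadd_coset m_gt1 n_gt1 krR idI rz)[y].
  by rewrite (hadd_x0 krR) => ->.
rewrite denz /denominator (bigD1 i0) //=.
rewrite (nary_binA n_gt1 mulRP) -bin_cosetE VE bin_cosetE /numerator.
by rewrite [in LHS]mul.[AC (1*2*1) (1*(2*(4*3)))].
Qed.

(** The congruence puts u q_1 s_p in u p_1 s_q + a with a in I. Dividing by u s_q s_p puts q in p +
    a/(u s_q s_p). *)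
Lemma coset_frac_sup (p q : R * den S) :
  quot_frac q = quot_frac p ->
  coset_set SI (frac p.1 p.2 : fractions S) (frac q.1 q.2).
Proof.
pose i0 : 'I_m := Ordinal (ltnW m_gt1); pose i1 : 'I_m := Ordinal m_gt1.
move=> /quot_frac_eqP[u Su /(coset_eqP m_gt1 n_gt1 krR idI)].
move=> /(coset_setP I m_gt1)[a Ia qpa].
have Sd : mset S (u * (sval q.2 * sval p.2)).
  by do 2!apply: mset_bin => //; exact: svalP.
pose d : den S := exist _ _ Sd.
pose P : 'I_m -> R * den S := pad (hzero R, den1 S) [:: p; (a, d)].
exists (fun j => frac (P j).1 (P j).2).
  move=> -[[|[|j]] jm] //=; first by exists a, d.
  by rewrite /P /= !nth_nil.
have Sds : mset S (sval d * sval p.2) by apply: mset_bin => //; exact: svalP.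
pose ds : den S := exist _ _ Sds.
have P1 (l : 'I_m) : l != i0 -> l != i1 -> sval (P l).2 = hone R.
  by case: l => -[|[|l]] lm; rewrite -!val_eqE //= /P /= nth_nil.
apply/(hadd_fractions n_gt1 mulRP); exists P => //.
(* Over the common denominator [sval d * sval p.2] both numerators carry a factor [sval p.2], hence
   this scaled representative of q. *)
exists (sval p.2 * (u * (q.1 * sval p.2)), ds); [split|].
- have -> : numerator P =
      pad (hzero R) [:: sval p.2 * (u * (p.1 * sval q.2)); sval p.2 * a].
    apply/funext=> j; rewrite /numerator.
    have [->|ji0] := eqVneq j i0.
      rewrite (bigD1 i1) //= big1 => [|l /andP[li0 li1]]; last exact: P1.
      by rewrite (nary_bin1 mulRP) [LHS]mul.[AC (1*(1*2)) (4*(2*(1*3)))].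
    have [->|ji1] := eqVneq j i1.
      rewrite (bigD1 i0) //= big1 => [|l /andP[li1 li0]]; last exact: P1.
      by rewrite (nary_bin1 mulRP) (nary_binC n_gt1 mulRP).
    rewrite (nary_binC n_gt1 mulRP).
    case: j ji0 ji1 => -[|[|j]] jm; rewrite -!val_eqE //= => _ _.
    by rewrite /P /= !nth_nil (bin_hmul0 n_gt1 krR).
  by rewrite -(hadd_mul2 n_gt1 krR); exists (u * (q.1 * sval p.2)).
- rewrite /= /denominator (bigD1 i0) //= (bigD1 i1) //= big1.
    by rewrite (nary_bin1 mulRP) (nary_binC n_gt1 mulRP).
  by move=> l /andP[li0 li1]; exact: P1.
- apply/(frac_eqP n_gt1 mulRP cancelR); exists (hone R); first exact: mset1.
  congr (_ * _) => /=.
  by rewrite [LHS]mul.[AC (1*((1*2)*1)) (5*(2*(1*4))*3)].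
Qed.

(** The two preceding lemmas turn membership in a coset of S^-1 I into an equality of [quot_frac]
    images. Cosets can thus be compared without the axioms of a Krasner hyperring for the fractions,
    which [coset_eqP] would require. *)
Lemma frac_quot_eqP (p q : R * den S) :
  frac_quot p = frac_quot q <-> quot_frac p = quot_frac q.
Proof.
split=> [/(congr1 sval) /= e|pq].
  by apply: coset_frac_sub; rewrite -e; exact: coset_frac_sup.
apply: eq_exist; apply/seteqP; split=> W; rewrite -[W]frac_reprK.
  by move=> /coset_frac_sub e; apply: coset_frac_sup; rewrite e.
by move=> /coset_frac_sub e; apply: coset_frac_sup; rewrite e.
Qed.

(** * The operations on pairs that induce those on both sides *)

Definition frac_sum (p : 'I_m -> R * den S) (q : R * den S) : Prop :=
  hadd R (numerator p) q.1 /\ sval q.2 = denominator p.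

Definition frac_prod (p : 'I_n -> R * den S) : R * den S :=
  (hmul R (fun j => (p j).1), den_mul (fun j => (p j).2)).

Lemma coset_big (J : finType) (P : pred J) (x : J -> R) :
  \big[nary_bin (hmul (quot I)) (hone (quot I))/hone (quot I)]_(j | P j)
    coset I (x j) =
  coset I (\big[mul/hone R]_(j | P j) x j).
Proof.
by apply/esym; apply: big_morph => // y z; rewrite bin_cosetE.
Qed.

Lemma hadd_quot_frac X Y :
  hadd (fractions Sbar) X Y <->
  exists2 p, (forall j, X j = quot_frac (p j)) &
  exists2 q, frac_sum p q & Y = quot_frac q.
Proof.
pose c (p : R * den S) : quot I * den Sbar := (coset I p.1, den_coset p.2).
have numE p : numerator (fun j => c (p j)) = fun j => coset I (numerator p j).
  by apply/funext=> j; rewrite /numerator /= coset_big bin_cosetE.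
have denE p : denominator (fun j => c (p j)) = coset I (denominator p).
  exact: coset_big.
rewrite (hadd_fractions n_gt1 mulQP).
split=> [[p' Xp' [q' []]]|[p Xp [q [pq dq] ->]]].
  have /(_ _)/cid-/all_sig[p pE] j : exists p, c p = p' j.
    have [s sE] := den_coset_surj (p' j).2.
    by exists (coset_repr (p' j).1, s); rewrite /c /= coset_reprK sE; case: (p' j).
  have -> : p' = fun j => c (p j) by apply/funext=> j; rewrite pE.
  rewrite numE denE => /(hadd_quot m_gt1 n_gt1 krR idI)[y py yE] dE YE.
  exists p; first by move=> j; rewrite Xp' -pE.
  (* [frac_sum] asks for exactly [denominator p], so the lift of q' takes this denominator rather
     than an arbitrary representative of its coset. *)
  have Sd : mset S (denominator p).
    by apply: mset_big => j; exact: svalP.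
  exists (y, exist _ _ Sd) => //; rewrite YE yE; congr frac.
  by case: (q'.2) dE => T ST dE; exact: eq_exist.
exists (fun j => c (p j)) => //; exists (c q) => //.
rewrite numE denE /= dq; split => //.
by apply/(hadd_quot m_gt1 n_gt1 krR idI); exists q.1.
Qed.

(** Both layers of the sum, cosets and fractions, quantify over all representatives, so unfolding
    them suffices. *)
Lemma hadd_frac_quot X Y :
  hadd (quot SI) X Y <->
  exists2 p, (forall j, X j = frac_quot (p j)) &
  exists2 q, frac_sum p q & Y = frac_quot q.
Proof.
split=> [[r Xr [y]]|[p Xp [q pq ->]]].
  move=> /(hadd_fractions n_gt1 mulRP)[p rp [q pq ->] ->].
  by exists p => [j|]; [rewrite Xr rp | exists q].
exists (fun j => frac (p j).1 (p j).2) => //; exists (frac q.1 q.2) => //.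
by apply/(hadd_fractions n_gt1 mulRP); exists p => //; exists q.
Qed.

Lemma hmul_quot_frac p :
  hmul (fractions Sbar) (fun j => quot_frac (p j)) = quot_frac (frac_prod p).
Proof.
rewrite (hmul_frac n_gt1 mulQP cancelQ) (hmul_coset m_gt1 n_gt1 krR idI).
congr frac; apply: eq_exist.
by rewrite -(hmul_coset m_gt1 n_gt1 krR idI).
Qed.

(** Independence of the representatives modulo S^-1 I is transferred by [frac_quot_eqP] to the
    fractions over R/I, where [hmul_quot_frac] provides it. *)
Lemma hmul_frac_quot p :
  hmul (quot SI) (fun j => frac_quot (p j)) = frac_quot (frac_prod p).
Proof.
pose w j := frac_repr (coset_repr (frac_quot (p j))).
transitivity (frac_quot (frac_prod w)).
  rewrite /frac_quot -(hmul_frac n_gt1 mulRP cancelR); congr (coset SI (hmul _ _)).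
  by apply/funext=> j; rewrite frac_reprK.
apply/frac_quot_eqP; rewrite -!hmul_quot_frac; congr hmul; apply/funext=> j.
by apply/frac_quot_eqP; rewrite /frac_quot frac_reprK coset_reprK.
Qed.

End FractionsOfQuotient.

Theorem theorem5p2 (m n : nat) (m_gt1 : 1 < m) (n_gt1 : 1 < n)
    (R : hyperalg m n) (krR : krasner_hyperring R)
    (mulC : symmetric_op (hmul R)) (R1 : scalar_identity (hone R))
    (S : multset R) (I : set R) (idI : hyperideal I)
    (SI0 : mset S `&` I = set0) :
  isomorphic (fractions (quot_multset m_gt1 n_gt1 krR idI S))
             (quot (frac_ideal S I)).
Proof.
apply: (presented_isomorphic (@quot_frac_surj _ _ m_gt1 n_gt1 R krR S I idI)
  (@frac_quot_surj _ _ R S I)).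
- exact: frac_quot_eqP.
- exact: hadd_quot_frac.
- exact: hadd_frac_quot.
- exact: hmul_quot_frac.
- exact: hmul_frac_quot.
Qed.
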